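(* Let $K$ be a field of characteristic zero and let $D=\partial_x+\sum_{i=1}^n\gamma_i(x)y_i^{k_i}\partial_i$ be a $K$-derivation of $K[x,y_1,\dots,y_n]$, where $k_i\geq 1$ are integers and $\gamma_i(x)\in K[x]$ for all $1\leq i\leq n$. Then $\operatorname{Im}D$ is a Mathieu-Zhao space of $K[x,y_1,\dots,y_n]$ if and only if $D$ is locally finite.
   Context: $\partial_x=\partial/\partial x$ and $\partial_i=\partial/\partial y_i$ on $R=K[x,y_1,\dots,y_n]$; $\operatorname{Im}D=D(R)$. A $K$-derivation $D$ of $R$ is locally finite if for every $a\in R$ the $K$-vector space spanned by the elements $D^i a$ ($i\geq 1$) is finite dimensional. A $K$-subspace $M$ of $R$ is a Mathieu-Zhao space of $R$ if, for every $a\in R$ such that $a^m\in M$ for all sufficiently large $m$, and every $b\in R$, one has $ba^m\in M$ for all sufficiently large $m$. *)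

(* Defs.v *)
From HB Require Import structures.
From mathcomp Require Import all_boot all_order all_algebra.
From mathcomp.multinomials Require Export mpoly.

Set Implicit Arguments.
Unset Strict Implicit.
Unset Printing Implicit Defensive.

Import GRing.Theory.
Local Open Scope ring_scope.

Definition is_subspace (K : fieldType) (A : comAlgType K) (M : A -> Prop) : Prop :=
  M 0 /\ forall (c : K) (a b : A), M a -> M b -> M (c *: a + b).

Definition in_span (K : fieldType) (A : comAlgType K) (S : A -> Prop) (f : A) : Prop :=
  exists (m : nat) (c : 'I_m -> K) (g : 'I_m -> A),
    (forall j, S (g j)) /\ f = \sum_(j < m) c j *: g j.

Definition finite_dim (K : fieldType) (A : comAlgType K) (V : A -> Prop) : Prop :=
  exists (m : nat) (e : 'I_m -> A),
    forall f, V f <-> exists c : 'I_m -> K, f = \sum_(j < m) c j *: e j.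

Definition is_derivation (K : fieldType) (A : comAlgType K) (D : A -> A) : Prop :=
  (forall (c : K) (a b : A), D (c *: a + b) = c *: D a + D b) /\
  (forall a b : A, D (a * b) = D a * b + a * D b).

Definition locally_finite (K : fieldType) (A : comAlgType K) (D : A -> A) : Prop :=
  is_derivation D /\
  forall a : A, finite_dim (in_span (fun f => exists2 i, (1 <= i)%N & f = iter i D a)).

Definition Im_of (K : fieldType) (A : comAlgType K) (D : A -> A) : A -> Prop :=
  fun f => exists a : A, f = D a.

Definition eventually_nat (P : nat -> Prop) : Prop :=
  exists N : nat, forall m : nat, (N <= m)%N -> P m.

Definition Mathieu_Zhao (K : fieldType) (A : comAlgType K) (M : A -> Prop) : Prop :=
  is_subspace M /\
  forall a : A, eventually_nat (fun m => M (a ^+ m)) ->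
  forall b : A, eventually_nat (fun m => M (b * a ^+ m)).

(* K[x, y_1, ..., y_n] is {mpoly K[n.+1]}: x is the variable of index ord0,
   and y_1, ..., y_n are the variables of index lift ord0 i for i : 'I_n. *)
Definition xindex (n : nat) : 'I_n.+1 := ord0.
Definition yindex (n : nat) (i : 'I_n) : 'I_n.+1 := lift ord0 i.

Definition polyx (K : fieldType) (n : nat) (g : {poly K}) : {mpoly K[n.+1]} :=
  \sum_(j < size g) g`_j *: 'X_(xindex n) ^+ j.

Definition Dxy (K : fieldType) (n : nat) (gamma : 'I_n -> {poly K}) (k : 'I_n -> nat)
    (f : {mpoly K[n.+1]}) : {mpoly K[n.+1]} :=
  mderiv (xindex n) f +
  \sum_(i < n) polyx n (gamma i) * 'X_(yindex i) ^+ k i * mderiv (yindex i) f.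

Lemma Dxy_is_derivation (K : fieldType) (n : nat) (gamma : 'I_n -> {poly K})
    (k : 'I_n -> nat) : is_derivation (Dxy gamma k).
Proof.
split=> [c a b|a b]; rewrite /Dxy.
  rewrite linearP scalerDr addrACA; congr (_ + _).
  rewrite scaler_sumr -big_split /=.
  by apply: eq_bigr => i _; rewrite linearP mulrDr scalerAr.
rewrite mderivM mulrDl mulrDr addrACA; congr (_ + _).
rewrite mulr_suml mulr_sumr -big_split /=.
by apply: eq_bigr => i _; rewrite mderivM mulrDr [a * (_ * _)]mulrCA !mulrA.
Qed.

(* Main.v *)
From HB Require Import structures.
Require Import Defs.
From mathcomp Require Import all_boot all_order all_algebra.

Set Implicit Arguments.
Unset Strict Implicit.
Unset Printing Implicit Defensive.

Import GRing.Theory.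
Local Open Scope ring_scope.

(** The image of D contains 1 = D x, and a Mathieu-Zhao space that contains
    1 is the whole ring. So the claim is that D is surjective if and only if
    it is locally finite.

    Suppose that D is locally finite. Any a in the ring satisfies a
    nontrivial linear relation between its iterates D^j a, so for some t and
    c != 0 the element c a + D w is killed by D^(t + 1). Because D x = 1,
    elements killed by a power of D can be integrated by parts with respect
    to x, so they are in the image, and so is a
    ([slice_locally_finite_surjective]).

    Suppose that D is surjective. Setting y_j = 0 for all j != i and writing
    y for y_i turns D into a derivation in two variables, hence y is in the
    image of the derivation d/dx + gamma_i(x) y^(k_i) d/dy of K[x, y]
    ([xy_proj_Dxy]). Comparing coefficients of powers of y, this forces
    gamma_i = 0, or k_i = 1 and gamma_i constant ([Dxy2_preimage_y]). When
    this holds for all i, D does not raise the total degree, so the iterates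
    of any element remain in a finite-dimensional space
    ([linear_Dxy_locally_finite]). *)

(** * Linear dependence *)

Definition spanned_by (K : fieldType) (V : lmodType K) (I : finType)
    (e : I -> V) (f : V) : Prop :=
  exists c : I -> K, f = \sum_i c i *: e i.

Section SpannedBy.
Variables (K : fieldType) (V : lmodType K) (I : finType) (e : I -> V).

Lemma spanned_by0 : spanned_by e 0.
Proof. by exists (fun=> 0); rewrite big1 // => i _; rewrite scale0r. Qed.

Lemma spanned_byD f g : spanned_by e f -> spanned_by e g -> spanned_by e (f + g).
Proof.
move=> [c ->] [d ->]; exists (fun i => c i + d i).
by rewrite -big_split; apply: eq_bigr => i _; rewrite scalerDl.
Qed.

Lemma spanned_byZ a f : spanned_by e f -> spanned_by e (a *: f).
Proof.
move=> [c ->]; exists (fun i => a * c i).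
by rewrite scaler_sumr; apply: eq_bigr => i _; rewrite scalerA.
Qed.

Lemma spanned_by_sum (J : finType) (P : pred J) (F : J -> V) :
  (forall j, P j -> spanned_by e (F j)) -> spanned_by e (\sum_(j | P j) F j).
Proof. exact: (big_ind _ spanned_by0 spanned_byD). Qed.

Lemma spanned_by_gen i : spanned_by e (e i).
Proof.
exists (fun j => (j == i)%:R); rewrite (bigD1 i) //= eqxx scale1r.
by rewrite big1 ?addr0 // => j /negPf ->; rewrite scale0r.
Qed.

(** More vectors than generators: the coordinate matrix has more rows than
    columns, and a nonzero vector of its left kernel is a linear relation. *)
Lemma linear_dependence (N : nat) (v : 'I_N -> V) :
    (#|I| < N)%N -> (forall j, spanned_by e (v j)) ->
  exists2 c : 'I_N -> K, exists j, c j != 0 & \sum_j c j *: v j = 0.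
Proof.
move=> ltIN /fin_all_exists[C vE].
pose M := \matrix_(j < N, i < #|I|) C j (enum_val i).
have : kermx M != 0.
  rewrite kermx_eq0 /row_free neq_ltn.
  by rewrite (leq_ltn_trans (rank_leq_col M) ltIN).
case/rowV0Pn => u /sub_kermxP uM0 /rV0Pn[j0 uj0].
exists (u 0); first by exists j0.
under eq_bigr => j _ do rewrite vE scaler_sumr.
rewrite exchange_big big1 // => i _.
under eq_bigr => j _ do rewrite scalerA.
rewrite -scaler_suml.
have /rowP/(_ (enum_rank i)) := uM0; rewrite !mxE => sum0.
rewrite [X in X *: _](_ : _ = 0) ?scale0r // -[RHS]sum0.
by apply: eq_bigr => j _; rewrite mxE enum_rankK.
Qed.

End SpannedBy.

(** * Iterates of a linear map *)

Section LinearIterates.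
Variables (K : fieldType) (A : comAlgType K) (D : {linear A -> A}).

Lemma iter_linear n : linear (iter n D).
Proof. by elim: n => // n IHn c a b; rewrite !iterS IHn linearP. Qed.

HB.instance Definition _ n :=
  GRing.isLinear.Build K A A *:%R (iter n D) (iter_linear n).

(** Integration by parts, with s in the role of the variable:
    (i + 1) s^i u = D (s^(i + 1) u) - s^(i + 1) (D u), where D u is killed by
    one iterate fewer.  The power s^i is what makes the induction go through;
    the case of interest is i = 0. *)
Lemma slice_integral (s : A) :
    [pchar K] =i pred0 -> is_derivation D -> D s = 1 ->
  forall n u, iter n D u = 0 -> forall i, Im_of D (s ^+ i * u).
Proof.
move=> /pcharf0P charK0 [_ DM] Ds1.
have DX i : D (s ^+ i.+1) = i.+1%:R *: s ^+ i.
  elim: i => [|i IHi]; first by rewrite expr1 Ds1 expr0 scale1r.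
  rewrite exprS DM Ds1 mul1r IHi -scalerAr -exprS.
  by rewrite -[X in X + _]scale1r -scalerDl nat1r.
elim=> [|n IHn] u /=.
  by move=> -> i; exists 0; rewrite mulr0 linear0.
rewrite -iterS iterSr => /IHn DuP i.
have [w Dw] := DuP i.+1.
exists (i.+1%:R^-1 *: (s ^+ i.+1 * u - w)).
rewrite linearZ /= linearB DM DX -Dw addrK -scalerAl scalerA mulVf ?scale1r //.
by rewrite charK0.
Qed.

(** A linear relation between the iterates D^(j + 1) a, with first nonzero
    coefficient c_t, reads D^(t + 1) (c_t a + D w) = 0.  Hence c_t a + D w is in
    the image, and so is a. *)
Lemma slice_locally_finite_surjective (s : A) :
    [pchar K] =i pred0 -> D s = 1 -> locally_finite D ->
  forall a, Im_of D a.
Proof.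
move=> charK0 Ds1 [derD finD] a; have [m [e spanE]] := finD a.
pose v (j : 'I_m.+1) := iter j.+1 D a.
have [||c [j0 cj0] rel] := @linear_dependence _ _ _ e _ v.
- by rewrite card_ord.
- move=> j; apply/spanE; exists 1%N, (fun=> 1), (fun=> v j).
  by split=> [_|]; [exists j.+1 | rewrite big_ord1 scale1r].
case: (arg_minnP (P := fun j => c j != 0) val cj0) => t ct t_min.
pose w := \sum_(j < m.+1 | j != t) c j *: iter (j - t.+1) D a.
have Du0 : iter t.+1 D (c t *: a + D w) = 0.
  rewrite -rel (bigD1 t) // linearD linearZ; congr (_ + _).
  rewrite -[LHS]/(iter t.+1 D (D w)) -iterSr linear_sum; apply: eq_bigr => j j_t.
  have [->|cj] := eqVneq (c j) 0; first by rewrite !scale0r linear0.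
  have lt_tj : (t < j)%N by rewrite ltn_neqAle eq_sym j_t t_min.
  by rewrite linearZ /= -!iterS -iterD addSn subnKC.
have [z zE] := slice_integral charK0 derD Ds1 Du0 0.
exists ((c t)^-1 *: (z - w)).
by rewrite linearZ /= linearB -zE expr0 mul1r addrK scalerA mulVf ?scale1r.
Qed.

(** A linear relation between the iterates, with last nonzero coefficient at
    index t, expresses D^(t + 1) a through D a, ..., D^t a, whose span is thus
    stable under D.  This yields generators inside the span of the iterates,
    and not merely a finite-dimensional space containing it. *)
Lemma bounded_iterates_locally_finite :
    is_derivation D ->
    (forall a, exists (I : finType) (e : I -> A),
      forall i, spanned_by e (iter i D a)) ->
  locally_finite D.
Proof.
move=> derD bndD; split=> // a; have [I [e aP]] := bndD a.
pose v (j : 'I_#|I|.+1) := iter j.+1 D a.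
have [//||c [j0 cj0] rel] := @linear_dependence _ _ _ e _ v.
  by move=> j; apply: aP.
case: (arg_maxnP (P := fun j => c j != 0) val cj0) => t ct t_max.
pose g (j : 'I_t) := iter j.+1 D a.
have vt : spanned_by g (iter t.+1 D a).
  have -> : iter t.+1 D a = \sum_(j < #|I|.+1 | j != t) (- (c t)^-1 * c j) *: v j.
    apply: (scalerI ct); rewrite scaler_sumr.
    under eq_bigr => j _ do rewrite scalerA mulrA mulrN mulfV // mulN1r scaleNr.
    apply/eqP; rewrite sumrN -addr_eq0; apply/eqP.
    by rewrite -[RHS]rel [RHS](bigD1 t).
  apply: spanned_by_sum => j j_t.
  have [->|cj] := eqVneq (c j) 0.
    by rewrite mulr0 scale0r; apply: spanned_by0.
  have lt_jt : (j < t)%N by rewrite ltn_neqAle j_t; apply: t_max.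
  exact/spanned_byZ/(spanned_by_gen g (Ordinal lt_jt)).
have gP i : spanned_by g (iter i.+1 D a).
  elim: i => [|i [b aE]].
    have [t0|t_gt0] := posnP t.
      by move: vt; rewrite [X in spanned_by _ (iter X.+1 _ _)]t0.
    exact: (spanned_by_gen g (Ordinal t_gt0)).
  rewrite iterS aE linear_sum; apply: spanned_by_sum => j _.
  rewrite linearZ /= -iterS; apply: spanned_byZ.
  have := ltn_ord j; rewrite leq_eqVlt => /predU1P[-> //|lt_jt].
  exact: (spanned_by_gen g (Ordinal lt_jt)).
exists t, g => f; split=> [[m [c' [h [hP ->]]]] | [c' ->]]; last first.
  by exists t, c', g; split=> // j; exists j.+1.
apply: spanned_by_sum => j _; apply: spanned_byZ.
by case: (hP j) => [[//|i] _ ->].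
Qed.

End LinearIterates.

(** * Multivariate polynomials *)

Section MultivariatePolynomials.
Variables (R : comNzRingType) (n : nat).

Lemma mderivXU (i j : 'I_n) :
  mderiv i ('X_j : {mpoly R[n]}) = (i == j)%:R.
Proof.
rewrite mderivX mnm1E eq_sym; case: eqP => [->|_]; last by rewrite scale0r.
by rewrite scale1r -{1}[U_(j)%MM]add0m addmK mpolyX0.
Qed.

Lemma mpoly_subalg_ind (P : {mpoly R[n]} -> Prop) :
    (forall c, P c%:MP) -> (forall i, P 'X_i) ->
    (forall f g, P f -> P g -> P (f + g)) ->
    (forall f g, P f -> P g -> P (f * g)) ->
  forall f, P f.
Proof.
move=> PC PX PD PM; have P1 : P 1 by rewrite -mpolyC1.
elim/mpolyind => [|c m p _ _ Pp]; first by rewrite -mpolyC0.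
apply: (PD _ _ _ Pp); rewrite -mul_mpolyC mpolyXE_id; apply: (PM _ _ (PC c)).
apply: (big_ind P) => // i _; elim: (m i) => [|d IHd]; first by rewrite expr0.
by rewrite exprS; apply: PM.
Qed.

End MultivariatePolynomials.

(** * The two-variable case *)

Section TwoVariables.
Variable K : fieldType.

(** On K[x][y], encoded as polynomials in y with coefficients in K[x], this is
    the derivation d/dx + g(x) y^d d/dy. *)
Definition Dxy2 (g : {poly K}) (d : nat) (F : {poly {poly K}}) : {poly {poly K}} :=
  map_poly (@deriv K) F + g%:P * 'X^d * F^`().

Lemma coef_Dxy2 g d F m : (Dxy2 g d F)`_m =
  (F`_m)^`() + (if (m < d)%N then 0 else g * F`_(m - d).+1 *+ (m - d).+1).
Proof.
rewrite /Dxy2 coefD coef_map_id0 ?linear0 //; congr (_ + _).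
rewrite -mulrA coefCM coefXnM; case: ifP => _; first by rewrite mulr0.
by rewrite coef_deriv mulrnAr.
Qed.

Lemma Dxy2D g d F G : Dxy2 g d (F + G) = Dxy2 g d F + Dxy2 g d G.
Proof. by rewrite /Dxy2 raddfD /= derivD mulrDr addrACA. Qed.

Lemma Dxy2M g d F G : Dxy2 g d (F * G) = Dxy2 g d F * G + F * Dxy2 g d G.
Proof.
have mapM : map_poly (@deriv K) (F * G) =
    map_poly (@deriv K) F * G + F * map_poly (@deriv K) G.
  apply/polyP=> m; rewrite coefD coef_map !coefM /= linear_sum -big_split.
  by apply: eq_bigr => j _ /=; rewrite !coef_map derivM.
rewrite /Dxy2 mapM derivM; set h := _ * 'X^d.
rewrite (mulrDr h) (mulrDl _ _ G) (mulrDr F) addrACA.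
by congr (_ + (_ + _)); [rewrite mulrA | rewrite mulrCA].
Qed.

(** Comparing the coefficients of y: for d > 1 they give F_1' = 1, and then
    F_(m + d - 1)' = - m g F_m propagates a nonzero coefficient F_m to index
    m + d - 1, so F would have infinitely many nonzero coefficients when
    g != 0.  For d = 1 they give F_1' + g F_1 = 1, where the degree of g F_1
    exceeds that of F_1' and is positive if g is nonconstant. *)
Lemma Dxy2_preimage_y g d F :
  [pchar K] =i pred0 -> (0 < d)%N -> Dxy2 g d F = 'X ->
  (size g <= 1)%N && ((d == 1%N) || (g == 0)).
Proof.
move=> charK0 d_gt0 DF; have [->|g0] := eqVneq g 0; first by rewrite size_poly0 orbT.
have coefF m := coef_Dxy2 g d F m; rewrite DF in coefF.
rewrite orbF; case: d d_gt0 DF coefF => [//|[|d]] _ DF coefF.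
  rewrite andbT leqNgt; apply/negP => g_gt1.
  have := coefF 1%N; rewrite coefX /= subnn !mulr1n => /esym F1.
  have F1_0 : F`_1 != 0.
    by apply: contra_eqN F1 => /eqP ->; rewrite mulr0 linear0 addr0 eq_sym oner_eq0.
  have size_gF : size (g * F`_1) = (size g + size F`_1).-1 by rewrite size_mul.
  have size_gt0 : (0 < size (F`_1)%R)%N by rewrite size_poly_gt0.
  have := congr1 (fun p : {poly K} => size p) F1.
  rewrite size_poly1 addrC size_polyDl size_gF.
    by move=> sz1; have := leq_add g_gt1 size_gt0; rewrite -ltn_predRL sz1.
  rewrite (leq_trans (lt_size_deriv F1_0)) //.
  by case: (size g) g_gt1 => [|[|s]] // _; rewrite addSn /= leq_addl.
exfalso.
have F_neq0 j : F`_(1 + j * d.+1) != 0.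
  elim: j => [|j IHj].
    have := coefF 1%N; rewrite coefX /= addr0 => /esym F1.
    by apply: contra_eqN F1 => /eqP ->; rewrite linear0 eq_sym oner_eq0.
  (* m = 1 + (j + 1) (d + 1) is the index where the term g y^(d + 2) F' picks up
     the coefficient of F of index 1 + j (d + 1). *)
  have mE : (1 + j.+1 * d.+1 = d.+2 + j * d.+1)%N by rewrite mulSn.
  have := coefF (1 + j.+1 * d.+1)%N.
  rewrite coefX {1 3 4 5}mE -[(_ == 1)%N]/false ltnNge leq_addr addKn.
  move/esym; apply: contra_eqN => /eqP ->; rewrite linear0 add0r -scaler_nat.
  rewrite scaler_eq0 mulf_eq0 (negPf g0) (negPf IHj) orbF.
  by move/pcharf0P: charK0 => ->.
have := F_neq0 (size F); rewrite nth_default ?eqxx //.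
by rewrite (leq_trans _ (leq_addl _ _)) // leq_pmulr.
Qed.

End TwoVariables.

(** * The derivation of K[x, y_1, ..., y_n] *)

Section PolynomialDerivation.
Variables (K : fieldType) (n : nat) (gamma : 'I_n -> {poly K}) (k : 'I_n -> nat).

HB.instance Definition _ := GRing.isLinear.Build K {mpoly K[n.+1]} {mpoly K[n.+1]}
  *:%R (@Dxy K n gamma k) (Dxy_is_derivation gamma k).1.

Local Notation D := (Dxy gamma k).

Lemma Dxy_x : D 'X_(xindex n) = 1.
Proof.
rewrite /Dxy mderivXU eqxx big1 ?addr0 // => i _.
by rewrite mderivXU /= mulr0.
Qed.

Lemma Dxy_y i : D 'X_(yindex i) = polyx n (gamma i) * 'X_(yindex i) ^+ k i.
Proof.
rewrite /Dxy mderivXU /= add0r (bigD1 i) //= mderivXU eqxx mulr1.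
rewrite big1 ?addr0 // => j ji.
by rewrite mderivXU (inj_eq lift_inj) (negPf ji) mulr0.
Qed.

Lemma DxyC c : D c%:MP = 0.
Proof. by rewrite /Dxy mderivC big1 ?addr0 // => i _; rewrite mderivC mulr0. Qed.

Lemma polyxC (c : K) : polyx n c%:P = c%:MP.
Proof.
rewrite /polyx size_polyC; have [->|_] := eqVneq c 0.
  by rewrite big_ord0 mpolyC0.
by rewrite big_ord1 coefC expr0 -mul_mpolyC mulr1.
Qed.

(** The quotient map to K[x, y_i] that kills y_j for j != i.  As k_j >= 1, the
    derivation preserves the ideal generated by these y_j. *)
Definition xy_proj (i : 'I_n) : {mpoly K[n.+1]} -> {poly {poly K}} :=
  mmap (@polyC {poly K} \o @polyC K)
    (fun j => if j == xindex n then 'X%:P else if j == yindex i then 'X else 0).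

HB.instance Definition _ i := GRing.RMorphism.on (xy_proj i).

Lemma xy_projC i c : xy_proj i c%:MP = c%:P%:P.
Proof. by rewrite /xy_proj mmapC. Qed.

Lemma xy_projD i : {morph xy_proj i : f g / f + g}.
Proof. exact: rmorphD. Qed.

Lemma xy_projM i : {morph xy_proj i : f g / f * g}.
Proof. exact: rmorphM. Qed.

Lemma xy_projXU i j : xy_proj i 'X_j =
  if j == xindex n then 'X%:P else if j == yindex i then 'X else 0.
Proof. by rewrite /xy_proj mmapX mmap1U. Qed.

Lemma xy_proj_polyx i (g : {poly K}) : xy_proj i (polyx n g) = g%:P.
Proof.
rewrite -[in RHS](coefK g) poly_def !rmorph_sum; apply: eq_bigr => j _ /=.
rewrite -mul_mpolyC rmorphM rmorphXn /= xy_projC xy_projXU eqxx.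
by rewrite -mul_polyC rmorphM rmorphXn.
Qed.

(** Both sides are derivations along xy_proj, so it is enough to compare them
    on the variables. *)
Lemma xy_proj_Dxy i f :
  (forall j, 0 < k j)%N -> xy_proj i (D f) = Dxy2 (gamma i) (k i) (xy_proj i f).
Proof.
move=> k_gt0; elim/mpoly_subalg_ind: f => [c|j|f g fP gP|f g fP gP].
- rewrite DxyC rmorph0 xy_projC /Dxy2 derivC mulr0 addr0.
  by rewrite map_polyC /= derivC polyC0.
- case: (unliftP ord0 j) => [j' ->|->]; last first.
    rewrite Dxy_x rmorph1 xy_projXU eqxx /Dxy2 derivC mulr0 addr0.
    by rewrite map_polyC /= derivX.
  rewrite Dxy_y rmorphM rmorphXn /= xy_proj_polyx xy_projXU /=.
  rewrite (inj_eq lift_inj); case: eqP => [->|_].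
    rewrite /Dxy2 derivX mulr1 [map_poly _ _](_ : _ = 0) ?add0r //.
    by apply/polyP=> m; rewrite coef_map /= coefX coef0 linearMn /= derivC mul0rn.
  by rewrite expr0n gtn_eqF // mulr0 /Dxy2 raddf0 deriv0 mulr0 addr0.
- have -> : D (f + g) = D f + D g by exact: linearD.
  by rewrite xy_projD fP gP xy_projD Dxy2D.
- by rewrite (Dxy_is_derivation gamma k).2 xy_projD !xy_projM fP gP Dxy2M.
Qed.

(** Here the coefficient of each d/dy_i is a constant multiple of y_i, so the
    derivation does not raise the total degree. *)
Lemma msize_linear_Dxy (c : 'I_n -> K) (d : nat) (f : {mpoly K[n.+1]}) :
    (forall i, polyx n (gamma i) * 'X_(yindex i) ^+ k i = c i *: 'X_(yindex i)) ->
  (msize f <= d)%N -> (msize (D f) <= d)%N.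
Proof.
move=> cP fd.
have sum_le (J : finType) (F : J -> {mpoly K[n.+1]}) :
    (forall j, (msize (F j) <= d)%N) -> (msize (\sum_j F j) <= d)%N.
  move=> Fd; elim/big_ind: _ => // [|p q pd qd]; first by rewrite msize0.
  by rewrite (leq_trans (msizeD_le _ _)) // geq_max pd.
rewrite [f](mpolywE fd) linear_sum; apply: (sum_le) => m; rewrite linearZ /=.
apply: (leq_trans (msizeZ_le _ _)).
have md : (msize ('X_[m] : {mpoly K[n.+1]}) <= d)%N.
  by rewrite msizeX; apply: (valP m).
rewrite /Dxy (leq_trans (msizeD_le _ _)) // geq_max; apply/andP; split.
  rewrite mderivX (leq_trans (msizeZ_le _ _)) // (leq_trans _ md) //.
  by rewrite !msizeX ltnS mdegB.
apply: (sum_le) => i; rewrite cP mderivX -scalerAl.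
apply: (leq_trans (msizeZ_le _ _)); rewrite -scalerAr.
have [->|mi] := posnP (m (yindex i)); first by rewrite scale0r msize0.
apply: (leq_trans (msizeZ_le _ _)).
by rewrite -mpolyXD addmC submK // lep1mP -lt0n.
Qed.

Lemma linear_Dxy_locally_finite :
  (forall i, (size (gamma i) <= 1)%N && ((k i == 1%N) || (gamma i == 0))) ->
  locally_finite D.
Proof.
move=> gk; apply: bounded_iterates_locally_finite; first exact: Dxy_is_derivation.
have cP i : polyx n (gamma i) * 'X_(yindex i) ^+ k i = (gamma i)`_0 *: 'X_(yindex i).
  have /andP[/size1_polyC gE /predU1P[-> | /eqP g0]] := gk i.
    by rewrite [in LHS]gE polyxC mul_mpolyC expr1.
  by rewrite g0 /polyx size_poly0 big_ord0 mul0r coef0 scale0r.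
move=> a; set d := msize a.
exists 'X_{1..n.+1 < d}, (fun m : 'X_{1..n.+1 < d} => 'X_[m]) => i.
have Da : (msize (iter i D a) <= d)%N.
  by elim: i => // i IHi; rewrite iterS (msize_linear_Dxy cP).
by exists (fun m : 'X_{1..n.+1 < d} => (iter i D a)@_m); apply: mpolywE.
Qed.

End PolynomialDerivation.

(** Take a = 1 in the definition: all its powers are in M. *)
Lemma Mathieu_Zhao_1 (K : fieldType) (A : comAlgType K) (M : A -> Prop) :
  Mathieu_Zhao M -> M 1 -> forall b, M b.
Proof.
move=> [_ MZ] M1 b; have [|N NP] := MZ 1 _ b; first by exists 0%N => m _; rewrite expr1n.
by have := NP N (leqnn N); rewrite expr1n mulr1.
Qed.

Theorem corollary5p2 (K : fieldType) (charK0 : [pchar K] =i pred0) (n : nat)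
    (gamma : 'I_n -> {poly K}) (k : 'I_n -> nat) (k_ge1 : forall i, (1 <= k i)%N) :
  Mathieu_Zhao (Im_of (Dxy gamma k)) <-> locally_finite (Dxy gamma k).
Proof.
split=> [MZ | locfin].
  apply: linear_Dxy_locally_finite => i.
  have Im1 : Im_of (Dxy gamma k) 1 by exists 'X_(xindex n); rewrite Dxy_x.
  have [f fE] := Mathieu_Zhao_1 MZ Im1 'X_(yindex i).
  apply: (Dxy2_preimage_y (F := xy_proj i f)) => //.
  by rewrite -xy_proj_Dxy // -fE xy_projXU eqxx.
have surj := slice_locally_finite_surjective charK0 (Dxy_x gamma k) locfin.
split; first by split=> [|*]; apply: surj.
by move=> a _ b; exists 0%N => m _; apply: surj.
Qed.
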